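(* Let $(M^{2n-1},\xi)$ be a contact manifold with a contact form $\lambda$ whose Reeb field $v$ is tangent to a co-Legendrian foliation $\mathcal F$ on $M$. Let $f_1,\dots,f_{n-1}$ be locally defined real functions on $M$ whose common level surfaces are the leaves of $\mathcal F$, and let $u_i=X_{f_i}$, $i=1,\dots,n-1$, be the contact vector fields corresponding to $f_i$ via $\lambda$. Then the vector fields $v,u_1,\dots,u_{n-1}$ pairwise commute and span the foliation $\mathcal F$.
   Context: All objects are smooth. A contact manifold $(M^{2n-1},\xi)$ is a manifold of dimension $2n-1$ with a completely non-integrable hyperplane distribution $\xi$; a contact form $\lambda$ is a 1-form with $\ker\lambda=\xi$. The Reeb field $v$ of $\lambda$ is defined by $i_vd\lambda=0$, $\lambda(v)=1$. An $n$-dimensional foliation $\mathcal F$ on $M$ is co-Legendrian if it is transverse to $\xi$ and the distribution $T\mathcal F\cap\xi$ is integrable. The functions $f_1,\dots,f_{n-1}$ are functionally independent ($df_1,\dots,df_{n-1}$ linearly independent at each point of their domain). For a function $f$, the contact vector field $X_f$ is the unique vector field with $\lambda(X_f)=f$ and $L_{X_f}\lambda=df(v)\,\lambda$; in particular $X_1=v$. ''Span the foliation'' means that at each point these vector fields form a basis of the tangent space of the leaf of $\mathcal F$. *)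

(* Defs.v *)
From mathcomp Require Import all_boot all_order all_algebra.
From mathcomp Require Import all_classical all_reals all_analysis.
Set Implicit Arguments.
Unset Strict Implicit.
Unset Printing Implicit Defensive.
Import Order.TTheory GRing.Theory Num.Theory numFieldNormedType.Exports.
Local Open Scope classical_set_scope.
Local Open Scope ring_scope.

Section Smooth.
Context {R : realType} {V W : normedModType R}.

(* Used on open sets A of finite-dimensional spaces only. *)
Fixpoint C_on (k : nat) (A : set V) (f : V -> W) : Prop :=
  match k with
  | 0 => forall x, A x -> {for x, continuous f}
  | j.+1 => (forall x, A x -> differentiable f x) /\
            (forall w : V, C_on j A (fun x => 'D_w f x))
  end.

Definition smooth_on (A : set V) (f : V -> W) : Prop := forall k, C_on k A f.

End Smooth.

(* [chart_coord] and [chart_inv] are only meaningful on [chart_dom] and on its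
   image. *)
Record chart (R : realType) (m : nat) (T : topologicalType) := Chart {
  chart_dom : set T;
  chart_coord : T -> 'rV[R]_m;
  chart_inv : 'rV[R]_m -> T;
  chart_dom_open : open chart_dom;
  chart_image_open : open (chart_coord @` chart_dom);
  chart_coordK : forall p, chart_dom p -> chart_inv (chart_coord p) = p;
  chart_coord_continuous :
    forall p, chart_dom p -> {for p, continuous chart_coord};
  chart_inv_continuous :
    forall x, (chart_coord @` chart_dom) x -> {for x, continuous chart_inv} }.

Definition compatible (R : realType) (m : nat) (T : topologicalType)
    (c c' : chart R m T) : Prop :=
  smooth_on (chart_coord c @` (chart_dom c `&` chart_dom c'))
    (chart_coord c' \o chart_inv c) /\
  smooth_on (chart_coord c' @` (chart_dom c `&` chart_dom c'))
    (chart_coord c \o chart_inv c').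

Record manifold (R : realType) (m : nat) := Manifold {
  points :> topologicalType;
  atlas : set (chart R m points);
  manifold_hausdorff : hausdorff_space points;
  manifold_second_countable : @second_countable points;
  atlas_cover : forall p : points, exists c, atlas c /\ chart_dom c p;
  atlas_compatible : forall c c', atlas c -> atlas c' -> compatible c c';
  atlas_maximal : forall c,
    (forall c', atlas c' -> compatible c c') -> atlas c }.

Arguments atlas {R m} _.

Section Tensors.
Context {R : realType} {m : nat} {M : manifold R m}.
Implicit Types (p q : M) (U : set M) (f : M -> R).

Definition charted (c : chart R m M) p : Prop := atlas M c /\ chart_dom c p.

Definition chart_at p : chart R m M := projT1 (cid (atlas_cover p)).

(* Tangent vectors, covectors and 2-covectors at a point are given by their
   components in all the charts around it; [tangent] and [cotangent] are the
   classical transformation laws.  To make equality of tensors the equality of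
   functions, the components in a chart not containing the point are 0. *)
Definition vec := chart R m M -> 'rV[R]_m.
Definition covec := chart R m M -> 'cV[R]_m.
Definition vfield := M -> vec.
Definition oneform := M -> covec.

Definition transition (c c' : chart R m M) p : 'M[R]_m :=
  jacobian (chart_coord c' \o chart_inv c) (chart_coord c p).

Definition tangent p : set vec := [set w |
  (forall c, ~ charted c p -> w c = 0) /\
  (forall c c', charted c p -> charted c' p ->
     w c' = w c *m transition c c' p)].

Definition cotangent p : set covec := [set a |
  (forall c, ~ charted c p -> a c = 0) /\
  (forall c c', charted c p -> charted c' p ->
     a c = transition c c' p *m a c')].

Definition pairing p (a : covec) (w : vec) : R :=
  (w (chart_at p) *m a (chart_at p)) 0 0.

Definition smooth_fun_on U f : Prop := forall c, atlas M c ->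
  smooth_on (chart_coord c @` (chart_dom c `&` U))
    (f \o chart_inv c : 'rV[R]_m -> R^o).

Definition vfield_on U (X : vfield) : Prop :=
  (forall p, U p -> tangent p (X p)) /\
  (forall c, atlas M c ->
     smooth_on (chart_coord c @` (chart_dom c `&` U))
       (fun x => X (chart_inv c x) c)).

Definition oneform_on U (a : oneform) : Prop :=
  (forall p, U p -> cotangent p (a p)) /\
  (forall c, atlas M c ->
     smooth_on (chart_coord c @` (chart_dom c `&` U))
       (fun x => a (chart_inv c x) c)).

(* [partial g c p k] is the partial derivative, with respect to the k-th
   coordinate of the chart c, of a scalar function g defined near p. *)
Definition partial (g : M -> R) (c : chart R m M) p (k : 'I_m) : R :=
  'D_(delta_mx 0 k) (g \o chart_inv c : 'rV[R]_m -> R^o) (chart_coord c p).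

Definition differential f : oneform := fun p c =>
  if `[< charted c p >] then \col_k partial f c p k else 0.

(* [X, Y]^l = X^k d_k Y^l - Y^k d_k X^l *)
Definition bracket (X Y : vfield) : vfield := fun p c =>
  if `[< charted c p >] then
    \row_l \sum_k (X p c 0 k * partial (fun q => Y q c 0 l) c p k
                   - Y p c 0 k * partial (fun q => X q c 0 l) c p k)
  else 0.

(* (da)_{kl} = da(d_k, d_l) = d_k a_l - d_l a_k *)
Definition ext_deriv (a : oneform) : M -> chart R m M -> 'M[R]_m := fun p c =>
  if `[< charted c p >] then
    \matrix_(k, l) (partial (fun q => a q c l 0) c p k
                    - partial (fun q => a q c k 0) c p l)
  else 0.

Definition eval2 p (b : chart R m M -> 'M[R]_m) (w w' : vec) : R :=
  (w (chart_at p) *m b (chart_at p) *m (w' (chart_at p))^T) 0 0.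

Definition interior_product (w : vec) (b : chart R m M -> 'M[R]_m) : covec :=
  fun c => (w c *m b c)^T.

(* (L_X a)_l = X^k d_k a_l + a_k d_l X^k *)
Definition lie_form (X : vfield) (a : oneform) : oneform := fun p c =>
  if `[< charted c p >] then
    \col_l \sum_k (X p c 0 k * partial (fun q => a q c l 0) c p k
                   + a p c k 0 * partial (fun q => X q c 0 k) c p l)
  else 0.

Definition is_basis_of (I : finType) (b : I -> vec) (S : set vec) : Prop :=
  [/\ forall i, S (b i),
      forall a : I -> R, \sum_i a i *: b i = 0 -> forall i, a i = 0 &
      forall w, S w -> exists a : I -> R, w = \sum_i a i *: b i].

(* The value of a pairing does not depend on the chart used to compute it. *)
Lemma pairingE p a w c : cotangent p a -> tangent p w -> charted c p ->
  pairing p a w = (w c *m a c) 0 0.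
Proof.
move=> [_ ha] [_ hw] hc.
have h0 : charted (chart_at p) p := projT2 (cid (atlas_cover p)).
by rewrite /pairing (hw _ _ hc h0) (ha _ _ hc h0) mulmxA.
Qed.

End Tensors.

Section Foliations.
Context {R : realType} {m : nat}.

(* c sends p and q to points with the same coordinates of index >= k. *)
Definition same_plaque (T : topologicalType) (k : nat) (c : chart R m T)
    (p q : T) : Prop :=
  forall i : 'I_m, (k <= i)%N -> chart_coord c p 0 i = chart_coord c q 0 i.

(* A k-dimensional foliation is given by a foliated atlas: the coordinate
   changes are locally of the form (x, y) |-> (h1(x, y), h2(y)), where x stands
   for the first k coordinates and y for the other ones. *)
Record foliation (M : manifold R m) (k : nat) := Foliation {
  foliation_dim : (k <= m)%N;
  fcharts : set (chart R m M);
  fcharts_atlas : fcharts `<=` atlas M;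
  fcharts_cover : forall p : M, exists c, fcharts c /\ chart_dom c p;
  fcharts_compatible : forall c c' (p : M), fcharts c -> fcharts c' ->
    chart_dom c p -> chart_dom c' p ->
    exists2 N : set M, nbhs p N & forall q q', N q -> N q' ->
      same_plaque k c q q' -> same_plaque k c' q q' }.

Context {M : manifold R m} {k : nat} (F : foliation M k).

Definition leaf_tangent (p : M) : set (@vec R m M) := [set w | tangent p w /\
  forall c, fcharts F c -> chart_dom c p ->
    forall i : 'I_m, (k <= i)%N -> w c 0 i = 0].

(* The leaf through p of the restriction of F to the open set U: the points
   joined to p by a path in U that moves along the plaques, i.e. whose
   transverse coordinates in the foliated charts are locally constant. *)
Definition leaf_in (U : set M) (p : M) : set M := [set q |
  exists g : R -> M,
    [/\ {within `[0, 1], continuous g}, g 0 = p, g 1 = q,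
        forall t, t \in `[0, 1] -> U (g t) &
        forall c t, fcharts F c -> t \in `[0, 1] -> chart_dom c (g t) ->
          \forall s \near t, s \in `[0, 1] -> same_plaque k c (g s) (g t)]].

(* The leaves of F in U are the common level surfaces (the connected components
   of the common level sets) of the functions f i. *)
Definition leaves_are_levels (I : finType) (U : set M) (f : I -> M -> R) :
    Prop :=
  forall p, U p ->
    leaf_in U p =
    connected_component [set q | U q /\ forall i, f i q = f i p] p.

End Foliations.

Section Contact.
Context {R : realType} {m : nat} {M : manifold R m}.
Implicit Types (U : set M) (a la : @oneform R m M) (v X : @vfield R m M).

Definition plane_field := M -> set (@vec R m M).

Definition defines_on U a (xi : plane_field) : Prop :=
  [/\ oneform_on U a, forall p, U p -> a p <> 0 &
      forall p, U p -> xi p = [set w | tangent p w /\ pairing p (a p) w = 0]].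

Definition hyperplane_distribution (xi : plane_field) : Prop :=
  forall p, exists U a, [/\ open U, U p & defines_on U a xi].

(* Complete non-integrability: the differential of a local 1-form defining xi is
   nondegenerate on xi.  This does not depend on the local form. *)
Definition completely_nonintegrable (xi : plane_field) : Prop :=
  forall U a, open U -> defines_on U a xi ->
    forall p, U p -> forall w, xi p w ->
      (forall w', xi p w' -> eval2 p (ext_deriv a p) w w' = 0) -> w = 0.

Definition contact_structure (xi : plane_field) : Prop :=
  hyperplane_distribution xi /\ completely_nonintegrable xi.

Definition contact_form la (xi : plane_field) : Prop := defines_on setT la xi.

Definition reeb_field la v : Prop :=
  vfield_on setT v /\
  forall p, interior_product (v p) (ext_deriv la p) = 0 /\
    pairing p (la p) (v p) = 1.

(* X is the contact vector field X_f on the open set U; v is the Reeb field. *)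
Definition contact_vfield_on U la v (f : M -> R) X : Prop :=
  vfield_on U X /\
  forall p, U p ->
    pairing p (la p) (X p) = f p /\
    lie_form X la p = pairing p (differential f p) (v p) *: la p.

Definition integrable_distribution (k : nat) (D : plane_field) : Prop :=
  exists G : foliation M k, forall p, leaf_tangent G p = D p.

Definition transverse (k : nat) (F : foliation M k) (xi : plane_field) : Prop :=
  forall p w, tangent p w ->
    exists w1 w2, [/\ leaf_tangent F p w1, xi p w2 & w = w1 + w2].

(* A transverse intersection of an n-dimensional distribution with a hyperplane
   distribution has dimension n - 1. *)
Definition co_legendrian (n : nat) (F : foliation M n) (xi : plane_field) :
    Prop :=
  transverse F xi /\
  integrable_distribution (n - 1) (fun p => leaf_tangent F p `&` xi p).

Definition functionally_independent_on (I : finType) U (f : I -> M -> R) :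
    Prop :=
  forall p, U p -> forall a : I -> R,
    \sum_i a i *: (differential (f i) p : @covec R m M) = 0 ->
    forall i, a i = 0.

(* The family v, u_1, ..., u_k, with v at index [None]. *)
Definition with_reeb (k : nat) v (u : 'I_k -> @vfield R m M) (i : option 'I_k) :
  @vfield R m M := if i is Some j then u j else v.

End Contact.

(* Main.v *)
Require Import Defs.
From mathcomp Require Import all_boot all_order all_algebra.
From mathcomp Require Import all_classical all_reals all_analysis.
From mathcomp Require Import zify ring lra.
Set Implicit Arguments.
Unset Strict Implicit.
Unset Printing Implicit Defensive.
Import Order.TTheory GRing.Theory Num.Theory numFieldNormedType.Exports.
Local Open Scope classical_set_scope.
Local Open Scope ring_scope.

(** The theorem reduces to Cartan calculus once TF is shown to be its own
orthogonal for d(lambda).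

The distribution D = TF /\ xi is integrable and lambda vanishes on it, so
d(lambda) vanishes on D; as TF is spanned by D and v, and i_v d(lambda) = 0, it
vanishes on TF ([co_legendrian_isotropic]).  The kernel of d(lambda) is the line
of v, TF contains it, and dim TF = n with dim M = 2n - 1; counting dimensions,
TF is equal to its d(lambda)-orthogonal ([isotropic_self_orthogonal],
[orthogonal_leaf_tangent]).

The f_i are constant on the leaves, so df_i vanishes on TF
([differential_leaf_tangent]), in particular df_i(v) = 0 and L_{u_i} lambda = 0.
By the formula L_X lambda = i_X d(lambda) + d(lambda(X)) ([cartan_formula]) this
says i_{u_i} d(lambda) = - df_i, which vanishes on TF: u_i is tangent to F.
Contracting a linear relation between v and the u_i with d(lambda) gives a
relation between the df_i, so v, u_1, ..., u_{n-1} are independent, hence a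
basis of the n-dimensional space TF.

For the brackets, let X and Y be two of these fields and Z = [X, Y].  As L_X and
L_Y annihilate lambda, so does L_Z = [L_X, L_Y]; moreover
lambda(Z) = d(lambda)(X, Y) = 0, because X(lambda(Y)) = lambda(Z) and
Y(lambda(X)) = - lambda(Z) in the formula
d(lambda)(X, Y) = X(lambda(Y)) - Y(lambda(X)) - lambda(Z).  Then
i_Z d(lambda) = L_Z lambda - d(lambda(Z)) = 0, and a vector in the kernels of
both lambda and d(lambda) is zero by the contact condition.  This is computed in
coordinates ([local_bracket_in_kernel], [local_bracket_ext],
[bracket_eq0]).

The contact condition and the integrability of D are read in different charts;
the link is the tensoriality of the exterior derivative
([ext_deriv_transition]).  That law and L_{[X, Y]} = [L_X, L_Y] both rest on the
symmetry of second derivatives ([derive_comm]). *)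

(** * Smooth functions and the symmetry of second derivatives *)

Section Calculus.
Context {R : realType}.

Lemma near_eq_differentiable (V W : normedModType R) (f g : V -> W) (x : V) :
  {near x, f =1 g} -> differentiable f x -> differentiable g x.
Proof.
move=> fg fx; have fgx := nbhs_singleton fg.
have dg : g \o shift x = cst (g x) + 'd f x +o_ 0 id.
  have /eqaddoP fo := diff_locally fx.
  apply/eqaddoP => e e0; have := fo e e0; apply: filter_app.
  have : \forall h \near 0, f (h + x) = g (h + x).
    have fg' : \forall y \near x, f y = g y := fg.
    by rewrite (near_shift 0) subr0 in fg'.
  apply: filterS => h fgh.
  rewrite /= -![(_ + _ : _ -> _) _]/(_ + _) -![(- _ : _ -> _) _]/(- _) /=.
  by rewrite /cst/= fgh fgx.
have cf := diff_continuous fx.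
by apply/diff_locallyP; rewrite (diff_unique cf dg).
Unshelve. all: by end_near. Qed.

Lemma C_on_ext (V W : normedModType R) k (A : set V) (f g : V -> W) :
  open A -> {in A, f =1 g} -> C_on k A f -> C_on k A g.
Proof.
move=> oA; elim: k f g => [|k IH] f g fg /=.
  move=> cf x Ax; have := cf x Ax.
  rewrite /prop_for /continuous_at -(fg x (mem_set Ax)); apply: cvg_trans.
  apply: near_eq_cvg; near=> y; apply: fg; rewrite inE; near: y.
  exact: open_nbhs_nbhs.
case=> df Cf; split.
  move=> x Ax; apply: near_eq_differentiable (df x Ax).
  by near=> y; apply: fg; rewrite inE; near: y; exact: open_nbhs_nbhs.
move=> w; apply: IH (Cf w) => x /set_mem Ax; apply: near_eq_derive.
by near=> y; apply: fg; rewrite inE; near: y; exact: open_nbhs_nbhs.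
Unshelve. all: try by end_near. Qed.

Lemma C_on_entry (V : normedModType R) n p k (A : set V) (f : V -> 'M[R]_(n, p))
    (i : 'I_n) (j : 'I_p) :
  open A -> C_on k A f -> C_on k A (fun x => f x i j : R^o).
Proof.
move=> oA; elim: k f => [|k IH] f /=.
  move=> cf x Ax.
  exact: (continuous_comp (cf x Ax) (@coord_continuous _ _ _ i j _)).
case=> df Cf; split=> [x Ax|w].
  exact: (differentiable_comp (df x Ax) (@differentiable_coord _ _ _ _ i j)).
apply: (C_on_ext oA _ (IH _ (Cf w))) => x /set_mem Ax.
by rewrite derive_mx ?mxE//; exact/diff_derivable/df.
Qed.

Lemma smooth_on_differentiable (V W : normedModType R) (A : set V)
    (f : V -> W) x :
  smooth_on A f -> A x -> differentiable f x.
Proof. by move=> /(_ 1%N) [+ _]; exact. Qed.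

Lemma smooth_on_derive (V W : normedModType R) (A : set V) (f : V -> W) w :
  smooth_on A f -> smooth_on A (fun x => 'D_w f x).
Proof. by move=> sf k; have [_] := sf k.+1; exact. Qed.

Lemma is_derive_line (V W : normedModType R) (f : V -> W) (x v : V) (t : R) :
  differentiable f (x + t *: v) ->
  is_derive t 1 (fun s : R => f (x + s *: v)) ('D_v f (x + t *: v)).
Proof.
move=> df; have /derivableP := @diff_derivable _ _ _ f _ v df.
pose g (s : R) := f (x + s *: v).
have E : (fun h : R => h^-1 *: ((g \o shift t) (h *: (1 : R)) - g t)) =
    (fun h => h^-1 *: ((f \o shift (x + t *: v)) (h *: v) - f (x + t *: v))).
  apply/funext => h; rewrite /g/=; congr (_ *: (f _ - _)).
  by rewrite [h%:A]mulr1 scalerDl addrCA.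
by move=> [ex va]; split; [rewrite /derivable E|rewrite /derive E].
Qed.

(** Twice the mean value theorem: along v for the increment of f in the
direction w, then along w for the derivative of f in the direction v.  The left
side is symmetric in v and w, which is what makes [derive_comm] work. *)
Lemma second_difference_MVT (V : normedModType R) (f : V -> R^o) (x v w : V)
    (s : R) :
  0 < s ->
  (forall a b, 0 <= a <= s -> 0 <= b <= s ->
    differentiable f (x + a *: v + b *: w) /\
    differentiable (fun y => 'D_v f y : R^o) (x + a *: v + b *: w)) ->
  exists a b, [/\ 0 < a < s, 0 < b < s &
    f (x + s *: v + s *: w) - f (x + s *: v) - (f (x + s *: w) - f x) =
    'D_w (fun y => 'D_v f y : R^o) (x + a *: v + b *: w) * s * s].
Proof.
move=> s0 df.
have lin a b : x + a *: v + b *: w = (x + b *: w) + a *: v by rewrite addrAC.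
pose g (a : R) : R := f ((x + s *: w) + a *: v) - f ((x + 0 *: w) + a *: v).
pose dg (a : R) : R :=
  'D_v f (x + s *: w + a *: v) - 'D_v f (x + 0 *: w + a *: v).
have gE a : 0 <= a <= s -> is_derive (a : R^o) 1 (g : R^o -> R^o) (dg a).
  move=> ha; apply: is_deriveB; apply: is_derive_line; rewrite -lin.
    by apply: (df _ _ _ _).1; rewrite // lexx ltW.
  by apply: (df _ _ _ _).1; rewrite // lexx ltW.
have [||a] := @MVT R g dg 0 s s0.
- move=> a; rewrite in_itv/= => /andP[/ltW a0 /ltW a1].
  by apply: gE; rewrite a0.
- apply/derivable_within_continuous => a; rewrite in_itv/= => ha.
  by case: (gE _ ha).
rewrite in_itv/= => ha E1.
have ha' : 0 <= a <= s by case/andP: ha => /ltW -> /ltW ->.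
pose h (b : R) : R := 'D_v f (x + a *: v + b *: w).
pose dh (b : R) : R := 'D_w (fun y => 'D_v f y : R^o) (x + a *: v + b *: w).
have hE b : 0 <= b <= s -> is_derive (b : R^o) 1 (h : R^o -> R^o) (dh b).
  by move=> hb; apply: is_derive_line; apply: (df _ _ _ _).2.
have [||b] := @MVT R h dh 0 s s0.
- move=> b; rewrite in_itv/= => /andP[/ltW b0 /ltW b1].
  by apply: hE; rewrite b0.
- apply/derivable_within_continuous => b; rewrite in_itv/= => hb.
  by case: (hE _ hb).
rewrite in_itv/= => hb E2.
exists a, b; split => //.
have E3 : dg a = dh b * s by rewrite /dg -!lin -[s in RHS]subr0 -E2.
rewrite -[dh b * s]E3 -[in RHS](subr0 s) -E1 /g !scale0r !addr0.
rewrite (addrAC x (s *: w)); lra.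
Qed.

(** On a small parallelogram of sides s v and s w, the second difference of f is
s^2 times a value of either mixed derivative; both are continuous at x, so
letting the parallelogram shrink to x identifies their values there. *)
Theorem derive_comm (V : normedModType R) (A : set V) (f : V -> R^o)
    (x v w : V) :
  open A -> smooth_on A f -> A x ->
  'D_v (fun y => 'D_w f y : R^o) x = 'D_w (fun y => 'D_v f y : R^o) x.
Proof.
move=> oA sf Ax; apply/eqP; rewrite -subr_eq0 -normr_le0.
apply/ler_addgt0Pr => e e0; rewrite add0r.
have sd u := smooth_on_derive u sf.
have c u u' :
    {for x, continuous (fun y => 'D_u (fun y => 'D_u' f y : R^o) y : R^o)}.
  apply: differentiable_continuous.
  exact: smooth_on_differentiable (smooth_on_derive u (sd u')) Ax.
have e2 : 0 < e / 2 by rewrite divr_gt0.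
have nA : \forall y \near x, A y by apply: open_nbhs_nbhs.
have /cvgrPdist_le/(_ _ e2) n1 := c v w.
have /cvgrPdist_le/(_ _ e2) n2 := c w v.
have nn := filterI nA (filterI n1 n2).
have [d /= d0 dP] := (nbhs_ballP x _).1 (nn _ _).
(* The + 1 keeps the divisor positive when v = w = 0; the 2 makes the
   parallelogram lie strictly inside the ball of radius d. *)
pose s := d / (2 * (`|v| + `|w| + 1)).
have k0 : 0 < `|v| + `|w| + 1 by rewrite ltr_wpDl// addr_ge0.
have s0 : 0 < s by rewrite divr_gt0// mulr_gt0.
have inb a b : 0 <= a <= s -> 0 <= b <= s -> ball x d (x + a *: v + b *: w).
  move=> /andP[a0 ale] /andP[b0 ble].
  rewrite -ball_normE/= -addrA opprD addNKr normrN.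
  rewrite (le_lt_trans (ler_normD _ _))// !normrZ !ger0_norm//.
  rewrite (@le_lt_trans _ _ (s * (`|v| + `|w| + 1)))//.
    rewrite !mulrDr mulr1 ler_wpDr ?(ltW s0)//.
    by apply: lerD; apply: ler_wpM2r.
  rewrite /s invfM mulrA mulfVK ?gt_eqF//; lra.
have inb' a b : 0 <= a <= s -> 0 <= b <= s -> ball x d (x + a *: w + b *: v).
  by move=> *; rewrite addrAC; exact: inb.
have [a [b [ha hb E1]]] :=
  @second_difference_MVT V f x v w s s0 (fun a b ha hb =>
  conj (smooth_on_differentiable sf (dP _ (inb a b ha hb)).1)
       (smooth_on_differentiable (sd v) (dP _ (inb a b ha hb)).1)).
have [a' [b' [ha' hb' E2]]] :=
  @second_difference_MVT V f x w v s s0 (fun a b ha hb =>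
  conj (smooth_on_differentiable sf (dP _ (inb' a b ha hb)).1)
       (smooth_on_differentiable (sd w) (dP _ (inb' a b ha hb)).1)).
have wk (t : R) : 0 < t < s -> 0 <= t <= s by case/andP => /ltW -> /ltW ->.
have [_ [_ b1]] := dP _ (inb _ _ (wk _ ha) (wk _ hb)).
have [_ [b2 _]] := dP _ (inb' _ _ (wk _ ha') (wk _ hb')).
move: b1 b2 E1 E2; rewrite (addrAC x (s *: w)) /=.
set p := 'D_w _ (_ + _); set q := 'D_v _ (_ + _) => b1 b2 E1 E2.
(* E1 and E2 express the same second difference, so p and q agree. *)
clearbody p q.
have pq : p = q.
  have : p * s * s = q * s * s.
    by rewrite -E1 -E2 !opprB addrACA [RHS]addrACA [X in _ = _ + X]addrC.
  by move/mulIf => /(_ (lt0r_neq0 s0))/mulIf => /(_ (lt0r_neq0 s0)).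
move: b1 b2; rewrite -pq; move: ('D_w _ x) ('D_v _ x) => P Q b1 b2.
by rewrite -(subrKA p) (le_trans (ler_normD _ _))// (splitr e) lerD// distrC.
Qed.

Lemma derive_coord m (f : 'rV[R]_m -> R^o) (x w : 'rV[R]_m) :
  differentiable f x ->
  'D_w f x = \sum_k w 0 k * 'D_(delta_mx 0 k) f x.
Proof.
move=> df; rewrite deriveE// [in LHS](row_sum_delta w) linear_sum.
by apply: eq_bigr => k _; rewrite linearZ deriveE.
Qed.

Lemma is_derive_sum_mul (V : normedModType R) m (f g : 'I_m -> V -> R^o)
    (x v : V) :
  (forall i, derivable (f i) x v) -> (forall i, derivable (g i) x v) ->
  is_derive x v (fun y => \sum_i f i y * g i y : R^o)
    (\sum_i ('D_v (f i) x * g i x + f i x * 'D_v (g i) x)).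
Proof.
move=> df dg.
rewrite (_ : (fun y => _) = \sum_i (f i : V -> R^o) * (g i)); last first.
  by apply/funext => y; rewrite fct_sumE.
apply: is_derive_sum => i.
have := is_deriveM (derivableP (df i)) (derivableP (dg i)).
by move=> /is_derive_eq; apply; rewrite /GRing.scale/= addrC [g i x * _]mulrC.
Qed.

End Calculus.

Lemma C_on_sub (R : realType) (V W : normedModType R) k (A A' : set V)
    (f : V -> W) :
  A' `<=` A -> C_on k A f -> C_on k A' f.
Proof.
move=> sA; elim: k f => [|k IH] f /= Cf; first by move=> x /sA; exact: Cf.
by case: Cf => df Cf; split=> [x /sA|w]; [exact: df|exact/IH/Cf].
Qed.

Lemma line_continuous (R : realType) (V : normedModType R) (x v : V) (t : R) :
  {for t, continuous (fun h : R => h *: v + x)}.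
Proof. by apply: differentiable_continuous. Qed.

Lemma near_line (R : realType) (V : normedModType R) (x v : V) (P : set V) :
  (\forall y \near x, P y) -> \forall h \near (0 : R), P (h *: v + x).
Proof.
move=> nP.
by apply: (@line_continuous _ _ x v 0); rewrite /= scale0r add0r.
Qed.

Lemma derive_line_cst (R : realType) (V W : normedModType R) (f : V -> W)
    (x v : V) :
  (\forall h \near (0 : R), f (h *: v + x) = f x) -> 'D_v f x = 0.
Proof.
move=> fx; apply/lim_near_cst => //=.
by apply: filterS (nbhs_dnbhs fx) => h /= ->; rewrite subrr scaler0.
Qed.

(** * The bracket of two fields preserving a one-form, in coordinates *)

Local Opaque derive.

Section LocalBracket.
Context {R : realType} {m : nat}.
Implicit Types (f : 'rV[R]_m -> R^o) (X Y a : 'I_m -> 'rV[R]_m -> R^o).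

Local Notation D k f := (fun x => 'D_(delta_mx 0 k) f x : R^o).

Lemma along_coord X f p : differentiable f p ->
  'D_(\row_k X k p) f p = \sum_k X k p * D k f p.
Proof. by move=> /derive_coord ->; apply: eq_bigr => k _; rewrite mxE. Qed.

Definition local_bracket X Y k : 'rV[R]_m -> R^o :=
  fun x => \sum_j (X j x * D j (Y k) x - Y j x * D j (X k) x).

Definition local_lie X a l : 'rV[R]_m -> R^o :=
  fun x => \sum_k (X k x * D k (a l) x + a k x * D l (X k) x).

Definition local_ext a k l : 'rV[R]_m -> R^o :=
  fun x => D k (a l) x - D l (a k) x.

Context (A : set 'rV[R]_m) (a X Y : 'I_m -> 'rV[R]_m -> R^o).
Hypotheses (oA : open A) (sa : forall k, smooth_on A (a k))
  (sX : forall k, smooth_on A (X k)) (sY : forall k, smooth_on A (Y k))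
  (LX : forall l x, A x -> local_lie X a l x = 0)
  (LY : forall l x, A x -> local_lie Y a l x = 0)
  (aXY : forall x, A x ->
     \sum_k \sum_l X k x * local_ext a k l x * Y l x = 0).

(** Contracting L_Y a = 0 with X and L_X a = 0 with Y and subtracting gives
a([X, Y]) = da(X, Y), which is zero by assumption. *)
Lemma local_bracket_in_kernel x : A x ->
  \sum_k local_bracket X Y k x * a k x = 0.
Proof.
move=> Ax.
have eX : \sum_l \sum_k Y l x * (X k x * D k (a l) x)
        + \sum_l \sum_k Y l x * (a k x * D l (X k) x) = 0.
  rewrite -big_split/= big1// => l _; rewrite -!mulr_sumr -mulrDr -big_split/=.
  by rewrite [X in _ * X](LX l Ax) mulr0.
have eY : \sum_l \sum_k X l x * (Y k x * D k (a l) x)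
        + \sum_l \sum_k X l x * (a k x * D l (Y k) x) = 0.
  rewrite -big_split/= big1// => l _; rewrite -!mulr_sumr -mulrDr -big_split/=.
  by rewrite [X in _ * X](LY l Ax) mulr0.
have e1 : \sum_k local_bracket X Y k x * a k x =
    \sum_l \sum_k X l x * (a k x * D l (Y k) x)
  - \sum_l \sum_k Y l x * (a k x * D l (X k) x).
  rewrite [X in X - _]exchange_big [X in _ - X]exchange_big -sumrB.
  apply: eq_bigr => k _; rewrite -sumrB mulr_suml; apply: eq_bigr => j _.
  by rewrite mulrBl -!mulrA ![a k x * _]mulrC.
have e2 : 0 = \sum_l \sum_k Y l x * (X k x * D k (a l) x)
            - \sum_l \sum_k X l x * (Y k x * D k (a l) x).
  rewrite -[LHS](aXY Ax) [X in _ = X - _]exchange_big -sumrB.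
  apply: eq_bigr => k _; rewrite -sumrB; apply: eq_bigr => j _.
  rewrite /local_ext mulrBr mulrBl; congr (_ - _); first by rewrite mulrC.
  by rewrite -mulrA [_ * Y j x]mulrC.
move: eX eY e1 e2.
move: (\sum_l \sum_k Y l x * (X k x * _)) (\sum_l \sum_k Y l x * (a k x * _))
  (\sum_l \sum_k X l x * (Y k x * _)) (\sum_l \sum_k X l x * (a k x * _)).
by move=> s1 s2 s3 s4 h1 h2 -> h3; lra.
Qed.

(** With Z = [X, Y], the left side is i_Z da = L_Z a - d(a(Z)).  Here L_Z a =
L_X (L_Y a) - L_Y (L_X a) = 0, and a(Z) vanishes on the whole open set A.  The
proof spells this out: L_Y a = 0 is differentiated along X, L_X a = 0 along Y,
and the second derivatives of a cancel. *)
Lemma local_bracket_ext l x : A x ->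
  \sum_k local_bracket X Y k x * local_ext a k l x = 0.
Proof.
have key (s1 s2 s3 s4 s5 s6 s7 s8 s9 t1 t2 : R) :
    s1 + t1 + (s6 + s4) = 0 -> s2 + t2 + (s7 + s5) = 0 -> t1 = t2 ->
    s3 + s8 = 0 -> s3 = s4 - s5 + s6 - s7 -> s9 = s1 - s2 -> s9 - s8 = 0.
  by move=> *; lra.
move=> Ax.
have nA : \forall y \near x, A y by exact: open_nbhs_nbhs.
(* The values of X and Y at x are frozen: derivatives along the constant vectors
   u and w commute with coordinate derivatives. *)
pose u := \row_k X k x; pose w := \row_k Y k x.
have df f : smooth_on A f -> differentiable f x.
  by move=> sf; exact: smooth_on_differentiable sf Ax.
have dd f v : smooth_on A f -> derivable f x v by move=> /df/diff_derivable.
have sD f v : smooth_on A f -> smooth_on A (fun y => 'D_v f y : R^o).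
  exact: smooth_on_derive.
have swap f v v' : smooth_on A f ->
    'D_v (fun y => 'D_v' f y : R^o) x = 'D_v' (fun y => 'D_v f y : R^o) x.
  by move=> sf; exact: (derive_comm _ _ oA sf Ax).
have dsum (f g : 'I_m -> 'rV[R]_m -> R^o) v :
    (forall i, smooth_on A (f i)) -> (forall i, smooth_on A (g i)) ->
    is_derive x v (fun y => \sum_i f i y * g i y : R^o)
      (\sum_i 'D_v (f i) x * g i x + \sum_i f i x * 'D_v (g i) x).
  move=> sf sg; rewrite -big_split/=.
  by apply: is_derive_sum_mul => i; apply: dd.
have dlie (W : 'I_m -> 'rV[R]_m -> R^o) v : (forall k, smooth_on A (W k)) ->
    (forall l x, A x -> local_lie W a l x = 0) ->
    (\sum_k 'D_v (W k) x * D k (a l) x +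
     \sum_k W k x * 'D_v (D k (a l)) x) +
    (\sum_k 'D_v (a k) x * D l (W k) x +
     \sum_k a k x * 'D_v (D l (W k)) x) = 0.
  move=> sW LW.
  have i1 := dsum _ _ v sW (fun k => sD (a l) (delta_mx 0 k) (sa l)).
  have i2 := dsum _ _ v sa (fun k => sD (W k) (delta_mx 0 l) (sW k)).
  rewrite -(derive_val (is_derive := is_deriveD i1 i2)).
  apply: etrans (derive_cst (0 : R^o) x v); apply: near_eq_derive; near=> y.
  by apply: etrans (LW l y _); [rewrite /local_lie big_split|near: y].
(* L_Y a = 0 differentiated along X, and L_X a = 0 differentiated along Y. *)
have E1 := dlie Y u sY LY.
have E2 := dlie X w sX LX.
have sumD (W : 'I_m -> 'rV[R]_m -> R^o) f v : smooth_on A f ->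
    \sum_k W k x * 'D_v (D k f) x =
    'D_(\row_k W k x) (fun y => 'D_v f y : R^o) x.
  move=> sf; rewrite along_coord; last exact/df/sD.
  by apply: eq_bigr => k _; rewrite swap.
rewrite [X in (_ + X) + _](sumD Y (a l) u (sa l)) in E1.
rewrite [X in (_ + X) + _](sumD X (a l) w (sa l)) in E2.
have bE k : local_bracket X Y k x = 'D_u (Y k) x - 'D_w (X k) x.
  by rewrite /local_bracket sumrB !along_coord//; exact: df.
have dZ k : is_derive x (delta_mx 0 l) (local_bracket X Y k)
    ((\sum_j D l (X j) x * D j (Y k) x + 'D_u (D l (Y k)) x) -
     (\sum_j D l (Y j) x * D j (X k) x + 'D_w (D l (X k)) x)).
  rewrite -!sumD//.
  have i1 := dsum _ _ (delta_mx 0 l) sX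
    (fun j => sD (Y k) (delta_mx 0 j) (sY k)).
  have i2 := dsum _ _ (delta_mx 0 l) sY
    (fun j => sD (X k) (delta_mx 0 j) (sX k)).
  suff <- : (fun y => \sum_j X j y * D j (Y k) y : R^o) -
    (fun y => \sum_j Y j y * D j (X k) y : R^o) = local_bracket X Y k.
    exact: is_deriveB.
  by apply/funext => y; rewrite /local_bracket sumrB.
(* The derivative of a(Z) = 0. *)
have E3 : \sum_k D l (local_bracket X Y k) x * a k x +
          \sum_k local_bracket X Y k x * D l (a k) x = 0.
  rewrite -big_split/=.
  have i1 : is_derive x (delta_mx 0 l)
      (fun y => \sum_k local_bracket X Y k y * a k y : R^o) _ :=
    is_derive_sum_mul (fun k => @ex_derive _ _ _ _ _ _ _ (dZ k))
                      (fun k => dd _ (delta_mx 0 l) (sa k)).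
  rewrite -(derive_val (is_derive := i1)).
  apply: etrans (derive_cst (0 : R^o) x (delta_mx 0 l)).
  apply: near_eq_derive; near=> y.
  by rewrite /cst local_bracket_in_kernel//; near: y.
(* L_X a = 0 and L_Y a = 0 at x itself remove the first derivatives of a along
   X and Y. *)
have dlX k : 'D_u (a k) x = - \sum_j a j x * D k (X j) x.
  apply/eqP; rewrite -addr_eq0 along_coord; last exact: df.
  by rewrite -big_split/=; apply/eqP; exact: LX.
have dlY k : 'D_w (a k) x = - \sum_j a j x * D k (Y j) x.
  apply/eqP; rewrite -addr_eq0 along_coord; last exact: df.
  by rewrite -big_split/=; apply/eqP; exact: LY.
have E4 : \sum_k D l (local_bracket X Y k) x * a k x =
   \sum_k a k x * 'D_u (D l (Y k)) x - \sum_k a k x * 'D_w (D l (X k)) x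
   + \sum_k 'D_u (a k) x * D l (Y k) x - \sum_k 'D_w (a k) x * D l (X k) x.
  under eq_bigr do rewrite (derive_val (is_derive := dZ _)).
  under [X in _ = _ + X - _]eq_bigr do rewrite dlX mulNr mulr_suml.
  under [X in _ = _ - X]eq_bigr do rewrite dlY mulNr mulr_suml.
  rewrite !sumrN exchange_big [X in _ = _ - - X]exchange_big/= opprK.
  rewrite -!sumrB -big_split/=; apply: eq_bigr => k _.
  under [X in _ = _ - X + _]eq_bigr do rewrite -mulrA.
  under [X in _ = _ + X]eq_bigr do rewrite -mulrA.
  rewrite -!mulr_sumr.
  rewrite [X in _ = _ - _ * X + _](eq_bigr
    (fun j => D l (Y j) x * D j (X k) x)) => [|j _]; last by rewrite mulrC.
  rewrite [X in _ = _ + _ * X](eq_bigr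
    (fun j => D l (X j) x * D j (Y k) x)) => [|j _]; last by rewrite mulrC.
  by move: (a k x) (\sum_i _) (\sum_i _) ('D_u _ _) ('D_w _ _) => *; ring.
have E5 : \sum_k local_bracket X Y k x * D k (a l) x =
   \sum_k 'D_u (Y k) x * D k (a l) x - \sum_k 'D_w (X k) x * D k (a l) x.
  by rewrite -sumrB; apply: eq_bigr => k _; rewrite bE mulrBl.
rewrite /local_ext; under eq_bigr do rewrite mulrBr.
rewrite sumrB.
exact: key E1 E2 (swap (a l) w u (sa l)) E3 E4 E5.
Unshelve. all: by end_near. Qed.

End LocalBracket.

(** * Charts and the transformation law of exterior derivatives *)

Section Charts.
Context {R : realType} {m : nat} {M : manifold R m}.
Implicit Types (p q : M) (c : chart R m M) (U : set M) (f g : M -> R).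

(** How statements about points near p are moved to coordinates: the inverse of
a chart is continuous on the open image, so a neighborhood of p
contains the image of a neighborhood of the coordinates of p. *)
Lemma near_chart c p (P : set M) : chart_dom c p ->
  (\forall q \near p, P q) -> \forall y \near chart_coord c p,
    [/\ chart_dom c (chart_inv c y), chart_coord c (chart_inv c y) = y &
        P (chart_inv c y)].
Proof.
move=> cp nP.
have im : (chart_coord c @` chart_dom c) (chart_coord c p) by exists p.
have n1 : \forall y \near chart_coord c p, (chart_coord c @` chart_dom c) y.
  by apply: open_nbhs_nbhs; split => //; exact: chart_image_open.
have n2 : \forall y \near chart_coord c p, P (chart_inv c y).
  by apply: (chart_inv_continuous im); rewrite chart_coordK.
by apply: filterS2 n1 n2 => y [q cq <-]; rewrite chart_coordK.
Qed.

Lemma chart_image_restr_open c U : open U ->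
  open (chart_coord c @` (chart_dom c `&` U)).
Proof.
move=> oU; rewrite openE => _ [p [cp Up] <-].
have nU : \forall q \near p, U q by exact: open_nbhs_nbhs.
by apply: filterS (near_chart cp nU) => y [cy yE Uy]; exists (chart_inv c y).
Qed.

Lemma eq_partial f g c p k : chart_dom c p -> (\forall q \near p, f q = g q) ->
  partial f c p k = partial g c p k.
Proof.
move=> cp fg; apply: near_eq_derive.
by apply: filterS (near_chart cp fg) => y [].
Qed.

Definition differentiable_in c p f :=
  differentiable (f \o chart_inv c : 'rV[R]_m -> R^o) (chart_coord c p).

Lemma transition_smooth c c' p : charted c p -> charted c' p ->
  smooth_on (chart_coord c @` (chart_dom c `&` chart_dom c'))
    (chart_coord c' \o chart_inv c).
Proof. by move=> [cA _] [cA' _]; have [] := atlas_compatible cA cA'. Qed.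

Lemma transition_differentiable c c' p : charted c p -> charted c' p ->
  differentiable (chart_coord c' \o chart_inv c) (chart_coord c p).
Proof.
move=> hc hc'; apply: smooth_on_differentiable (transition_smooth hc hc') _.
by exists p => //; split; [case: hc|case: hc'].
Qed.

Lemma transitionE c c' p k l : charted c p -> charted c' p ->
  transition c c' p k l = partial (fun q => chart_coord c' q 0 l) c p k.
Proof.
move=> hc hc'; have df := transition_differentiable hc hc'.
rewrite /transition -[RHS]/('D_(delta_mx 0 k)
  (fun y => (chart_coord c' \o chart_inv c) y 0 l) _).
have := @derive_mx _ _ _ _ (chart_coord c' \o chart_inv c) (chart_coord c p)
  (delta_mx 0 k).
move=> /(_ (diff_derivable df)) /matrixP/(_ 0 l); rewrite mxE => <-.
by rewrite deriveEjacobian// -rowE [in RHS]mxE.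
Qed.

Lemma near_transition c c' p f : charted c p -> charted c' p ->
  \forall y \near chart_coord c p,
    (f \o chart_inv c) y =
    ((f \o chart_inv c') \o (chart_coord c' \o chart_inv c)) y.
Proof.
move=> [cA cp] [cA' cp'].
have n1 : \forall q \near p, chart_dom c' q.
  by apply: open_nbhs_nbhs; split => //; exact: chart_dom_open.
by apply: filterS (near_chart cp n1) => y [_ _ h] /=; rewrite chart_coordK.
Qed.

Lemma differentiable_in_chart c c' p f : charted c p -> charted c' p ->
  differentiable_in c' p f -> differentiable_in c p f.
Proof.
move=> hc hc' df.
have nt := near_transition f hc hc'.
apply: (@near_eq_differentiable R _ R^o
  ((f \o chart_inv c') \o (chart_coord c' \o chart_inv c))).
  by apply: filterS nt => y /esym.
apply: differentiable_comp; first exact: transition_differentiable.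
by rewrite /= chart_coordK//; case: hc.
Qed.

(** The chain rule.  It is the source of every transformation law below. *)
Lemma partial_transition c c' p f k : charted c p -> charted c' p ->
  differentiable_in c' p f ->
  partial f c p k = \sum_l transition c c' p k l * partial f c' p l.
Proof.
move=> hc hc' df; have dt := transition_differentiable hc hc'.
have E : (chart_coord c' \o chart_inv c) (chart_coord c p) = chart_coord c' p.
  by rewrite /= chart_coordK//; case: hc.
rewrite /partial.
rewrite (near_eq_derive _ (near_transition f hc hc')).
rewrite deriveE; last by apply: differentiable_comp => //; rewrite E.
rewrite diff_comp//; last by rewrite E.
rewrite E /= -[LHS]deriveE// derive_coord//; apply: eq_bigr => l _.
by rewrite -deriveE// deriveEjacobian// -rowE mxE.
Qed.

Local Opaque transition partial.

Lemma coord_differentiable_in c c' p l : charted c p -> charted c' p ->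
  differentiable_in c p (fun q => chart_coord c' q 0 l).
Proof.
move=> hc hc'.
exact: (differentiable_comp (transition_differentiable hc hc')
          (@differentiable_coord _ _ _ _ 0 l)).
Qed.

Lemma transition_trans c c' c'' p :
  charted c p -> charted c' p -> charted c'' p ->
  transition c c'' p = transition c c' p *m transition c' c'' p.
Proof.
move=> hc hc' hc''; apply/matrixP => k l; rewrite [RHS]mxE.
apply: (etrans (transitionE k l hc hc'')).
apply: (etrans (partial_transition k hc hc'
                  (coord_differentiable_in l hc' hc''))).
by apply: eq_bigr => j _; congr (_ * _); exact/esym/transitionE.
Qed.

Lemma transition_refl c p : charted c p -> transition c c p = 1%:M.
Proof.
move=> hc; apply/matrixP => k l; rewrite [RHS]mxE.
apply: (etrans (transitionE k l hc hc)).
have n1 : \forall q \near p, True by exact: nearW.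
apply: etrans (_ : 'D_(delta_mx 0 k) (fun y : 'rV[R]_m => y 0 l : R^o)
                     (chart_coord c p) = _).
  apply: near_eq_derive.
  by apply: filterS (near_chart hc.2 n1) => y [_ /= -> _].
have := @derive_mx _ _ 1 m (id : 'rV[R]_m -> 'rV[R]_m) (chart_coord c p)
  (delta_mx 0 k).
move=> /(_ (@derivable_id _ _ _ _)) /matrixP/(_ 0 l); rewrite mxE => <-.
by rewrite derive_id mxE eqxx/= eq_sym.
Qed.

Lemma charted_at p : charted (chart_at p) p.
Proof. exact: projT2 (cid (atlas_cover p)). Qed.

(** Used to turn statements about all tangent vectors into statements about
components in one convenient chart. *)
Definition vec_of_coords c p (w : 'rV[R]_m) : @vec R m M := fun c' =>
  if `[< charted c' p >] then w *m transition c c' p else 0.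

Lemma vec_of_coords_tangent c p w :
  charted c p -> tangent p (vec_of_coords c p w).
Proof.
move=> hc; split=> [c' nc'|c' c'' hc' hc'']; rewrite /vec_of_coords.
  by case: asboolP.
by rewrite (asboolT hc') (asboolT hc'') -mulmxA (transition_trans hc hc' hc'').
Qed.

Lemma vec_of_coordsK c p w : charted c p -> vec_of_coords c p w c = w.
Proof.
by move=> hc; rewrite /vec_of_coords (asboolT hc) (transition_refl hc) mulmx1.
Qed.

Lemma tangent_eq c p (w w' : @vec R m M) : charted c p ->
  tangent p w -> tangent p w' -> w c = w' c -> w = w'.
Proof.
move=> hc [w0 wt] [w0' wt'] e; apply/funext => c'.
have [hc'|nc'] := pselect (charted c' p); last first.
  by rewrite (w0 _ nc') (w0' _ nc').
by rewrite (wt _ _ hc hc') (wt' _ _ hc hc') e.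
Qed.

Lemma smooth_differentiable_in U f c p : open U -> U p -> smooth_fun_on U f ->
  charted c p -> differentiable_in c p f.
Proof.
move=> oU Up sf hc; apply: smooth_on_differentiable (sf c hc.1) _.
by exists p => //; split => //; case: hc.
Qed.

Lemma differential_cotangent U f p : open U -> U p -> smooth_fun_on U f ->
  cotangent p (differential f p).
Proof.
move=> oU Up sf; split=> [c nc|c c' hc hc']; rewrite /differential.
  by case: asboolP.
rewrite (asboolT hc) (asboolT hc'); apply/colP => k.
rewrite [LHS]mxE [RHS]mxE.
apply: etrans (partial_transition k hc hc'
                 (smooth_differentiable_in oU Up sf hc')) _.
by apply: eq_bigr => l _; congr (_ * _); rewrite mxE.
Qed.

Lemma oneform_differentiable_in U (a : @oneform R m M) c p l :
  open U -> U p -> oneform_on U a -> charted c p ->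
  differentiable_in c p (fun q => a q c l 0).
Proof.
move=> oU Up [_ sa] hc.
apply: (differentiable_comp _ (@differentiable_coord _ _ _ _ l 0)).
apply: smooth_on_differentiable (sa c hc.1) _.
by exists p => //; split => //; case: hc.
Qed.

Local Transparent partial.

(** Differentiating a_l = sum_i (d_l phi_i) a'_i, where phi is the change of
coordinates, gives the tensorial term plus sum_i (d_k d_l phi_i) a'_i; the
latter is symmetric in k and l, so antisymmetrizing removes it. *)
Lemma ext_deriv_transition U (a : @oneform R m M) c c' p :
  open U -> U p -> oneform_on U a -> charted c p -> charted c' p ->
  ext_deriv a p c =
    transition c c' p *m ext_deriv a p c' *m (transition c c' p)^T.
Proof.
move=> oU Up ha hc hc'; have sT := transition_smooth hc hc'.
set T := transition c c' p.
pose A := chart_coord c @` (chart_dom c `&` chart_dom c').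
have oA : open A by apply: chart_image_restr_open; exact: chart_dom_open.
have Ap : A (chart_coord c p) by exists p => //; split; [case: hc|case: hc'].
have sphi i : smooth_on A (fun y => (chart_coord c' (chart_inv c y)) 0 i : R^o).
  by move=> k; apply: C_on_entry => //; exact: sT.
(* The Hessians of the components of the change of coordinates. *)
pose S k l i := 'D_(delta_mx 0 k) (fun y => 'D_(delta_mx 0 l)
  (fun y => (chart_coord c' (chart_inv c y)) 0 i : R^o) y : R^o)
  (chart_coord c p).
have symS k l i : S k l i = S l k i by apply: derive_comm (sphi i) Ap.
have nW : \forall q \near p, [/\ charted c q, charted c' q & U q].
  have n1 : \forall q \near p, chart_dom c q.
    by apply: open_nbhs_nbhs; split; [exact: chart_dom_open|case: hc].
  have n2 : \forall q \near p, chart_dom c' q.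
    by apply: open_nbhs_nbhs; split; [exact: chart_dom_open|case: hc'].
  have n3 : \forall q \near p, U q by exact: open_nbhs_nbhs.
  near=> q; split; [split|split|by near: q]; try by near: q.
    by case: hc.
  by case: hc'.
pose d k l := partial (fun q => a q c l 0) c p k.
pose d' i j := partial (fun q => a q c' j 0) c' p i.
have dE k l : d k l = \sum_i S k l i * a p c' i 0 +
    \sum_i T l i * \sum_j T k j * d' j i.
  have da1 i : differentiable_in c' p (fun q => a q c' i 0).
    exact: oneform_differentiable_in oU Up ha hc'.
  have da' i : differentiable_in c p (fun q => a q c' i 0).
    exact: (differentiable_in_chart hc hc' (da1 i)).
  pose F i : 'rV[R]_m -> R^o := fun y =>
    'D_(delta_mx 0 l) (fun y => (chart_coord c' (chart_inv c y)) 0 i : R^o) y.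
  pose G i : 'rV[R]_m -> R^o := (fun q => a q c' i 0) \o chart_inv c.
  have dF i : derivable (F i) (chart_coord c p) (delta_mx 0 k).
    apply/diff_derivable/smooth_on_differentiable/Ap.
    exact/smooth_on_derive/sphi.
  have dG i : derivable (G i) (chart_coord c p) (delta_mx 0 k).
    exact/diff_derivable/da'.
  have i1 := is_derive_sum_mul dF dG.
  rewrite /d /partial; transitivity ('D_(delta_mx 0 k)
    (fun y => \sum_i F i y * G i y : R^o) (chart_coord c p)).
    apply: near_eq_derive.
    apply: filterS (near_chart hc.2 nW) => y [cy yE [h1 h2 h3]] /=.
    rewrite ((ha.1 _ h3).2 _ _ h1 h2) [LHS]mxE; apply: eq_bigr => i _.
    congr (_ * _); apply: etrans (transitionE l i h1 h2) _.
    by rewrite /partial yE.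
  rewrite (derive_val (is_derive := i1)) big_split/=; congr (_ + _).
    by apply: eq_bigr => i _; rewrite /G/= chart_coordK//; case: hc.
  apply: eq_bigr => i _; congr (_ * _).
    by rewrite /T transitionE.
  exact: (partial_transition k hc hc' (da1 i)).
apply/matrixP => k l.
have -> : ext_deriv a p c k l = d k l - d l k.
  by rewrite /ext_deriv (asboolT hc) mxE.
have -> : (T *m ext_deriv a p c' *m T^T) k l =
    \sum_i \sum_j T k j * (d' j i - d' i j) * T l i.
  rewrite mxE; apply: eq_bigr => i _; rewrite [X in X * _]mxE mulr_suml.
  apply: eq_bigr => j _; rewrite [T^T i l]mxE; congr (_ * _ * _).
  by rewrite /ext_deriv (asboolT hc') mxE.
rewrite !dE; under [X in X + _ - _]eq_bigr do rewrite symS.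
rewrite opprD addrACA subrr add0r.
under [X in X - _]eq_bigr do rewrite mulr_sumr.
under [X in _ - X]eq_bigr do rewrite mulr_sumr.
rewrite [X in _ - X]exchange_big -sumrB; apply: eq_bigr => i _.
rewrite -sumrB; apply: eq_bigr => j _.
by move: (T l i) (T k j) (d' j i) (d' i j) => t1 t2 t3 t4; ring.
Unshelve. all: by end_near. Qed.

End Charts.

(** * Foliated charts and leaves *)

Local Opaque transition.

Section FoliatedCharts.
Context {R : realType} {m k : nat} {M : manifold R m} (F : foliation M k).
Implicit Types (p q : M) (c : chart R m M) (U : set M) (f g : M -> R).

Lemma fcharts_charted c p : fcharts F c -> chart_dom c p -> charted c p.
Proof. by move=> Fc cp; split => //; exact: fcharts_atlas Fc. Qed.

Lemma same_plaque_line c p q (i : 'I_m) (h h' : R) (x : 'rV[R]_m) : (i < k)%N ->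
  chart_coord c p = h *: delta_mx 0 i + x ->
  chart_coord c q = h' *: delta_mx 0 i + x -> same_plaque k c p q.
Proof.
move=> ik ep eq j kj; rewrite ep eq !mxE eqxx/=.
have -> : (j == i) = false.
  by apply/negbTE/eqP => ji; move: ik; rewrite -ji ltnNge kj.
by rewrite !mulr0.
Qed.

(** Moving along the i-th axis of c, with i < k, stays in a plaque of c, hence
near p in a plaque of c', where the coordinates of index >= k do not vary. *)
Lemma transition_leaf_block c c' p (i j : 'I_m) :
  fcharts F c -> fcharts F c' -> chart_dom c p -> chart_dom c' p ->
  (i < k)%N -> (k <= j)%N -> transition c c' p i j = 0.
Proof.
move=> Fc Fc' cp c'p ik kj.
have hc := fcharts_charted Fc cp; have hc' := fcharts_charted Fc' c'p.
apply: etrans (transitionE i j hc hc') _.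
apply: derive_line_cst.
have [N nN NP] := fcharts_compatible Fc Fc' cp c'p.
have := near_line (delta_mx 0 i) (near_chart cp nN).
apply: filterS => h [ch hE Nh] /=; rewrite (chart_coordK cp).
apply: (NP _ _ Nh (nbhs_singleton nN)) kj.
by apply: (same_plaque_line ik hE (h' := 0)); rewrite scale0r add0r.
Qed.

(** Being tangent to the leaves can be tested in one foliated chart. *)
Lemma leaf_tangent_in_chart c p (w : @vec R m M) :
  fcharts F c -> chart_dom c p ->
  tangent p w -> (forall j : 'I_m, (k <= j)%N -> w c 0 j = 0) ->
  leaf_tangent F p w.
Proof.
move=> Fc cp tw w0; split => // c' Fc' c'p j kj.
rewrite (tw.2 _ _ (fcharts_charted Fc cp) (fcharts_charted Fc' c'p)) mxE.
rewrite big1// => i _; case: (ltnP i k) => ik; last by rewrite w0 ?mul0r.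
by rewrite (transition_leaf_block Fc Fc' cp c'p ik kj) mulr0.
Qed.

(** The coordinate segment itself is the path in U required by the definition of
leaves: it moves inside a plaque of c, and by compatibility of foliated charts
it moves locally inside the plaques of every other foliated chart. *)
Lemma line_in_leaf c p U (i : 'I_m) : fcharts F c -> chart_dom c p ->
  open U -> U p -> (i < k)%N ->
  \forall h \near (0 : R),
    leaf_in F U p (chart_inv c (h *: delta_mx 0 i + chart_coord c p)).
Proof.
move=> Fc cp oU Up ik.
have nU : \forall q \near p, U q by exact: open_nbhs_nbhs.
have := near_line (delta_mx 0 i) (near_chart cp nU).
set y := fun h : R => h *: delta_mx 0 i + chart_coord c p.
move=> /nbhs_ballP[d /= d0 dP].
apply/nbhs_ballP; exists d => //= h; rewrite -ball_normE/= sub0r normrN => hd.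
have H (t : R) : t \in `[0, 1] -> [/\ chart_dom c (chart_inv c (y (t * h))),
    chart_coord c (chart_inv c (y (t * h))) = y (t * h) &
    U (chart_inv c (y (t * h)))].
  rewrite in_itv/= => /andP[t0 t1]; apply: dP.
  rewrite -ball_normE/= sub0r normrN normrM ger0_norm//.
  by rewrite (le_lt_trans _ hd)// ler_piMl.
have cg (t : R) : t \in `[0, 1] ->
    {for t, continuous (fun t : R => chart_inv c (y (t * h)))}.
  move=> /H[ct ctE _].
  have c1 : {for t, continuous (fun t : R => y (t * h) : 'rV[R]_m)}.
    rewrite (_ : (fun _ => _) =
      fun t : R => t *: (h *: delta_mx 0 i) + chart_coord c p).
      exact: line_continuous.
    by apply/funext => r; rewrite scalerA.
  have c2 : {for y (t * h), continuous (chart_inv c)}.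
    by apply: chart_inv_continuous; exists (chart_inv c (y (t * h))).
  exact: (continuous_comp c1 c2).
exists (fun t : R => chart_inv c (y (t * h))); split.
- apply: continuous_in_subspaceT => t; rewrite inE => t01; exact: cg.
- by rewrite mul0r /y scale0r add0r chart_coordK.
- by rewrite mul1r.
- by move=> t /H[].
- move=> c' t Fc' t01 c't; have [ct ctE _] := H _ t01.
  have [N nN NP] := fcharts_compatible Fc Fc' ct c't.
  have nNs : \forall s \near t, N (chart_inv c (y (s * h))) := cg t t01 N nN.
  apply: filterS nNs => s Ns s01.
  have [_ csE _] := H _ s01.
  apply: (NP _ _ Ns (nbhs_singleton nN)).
  exact: (same_plaque_line ik csE ctE).
Qed.

Lemma partial_leaf_constant c p U f (i : 'I_m) : fcharts F c -> chart_dom c p ->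
  open U -> U p -> (forall q, leaf_in F U p q -> f q = f p) -> (i < k)%N ->
  partial f c p i = 0.
Proof.
move=> Fc cp oU Up fp ik; apply: derive_line_cst.
apply: filterS (line_in_leaf Fc cp oU Up ik) => h /fp /= ->.
by rewrite chart_coordK.
Qed.

Lemma differential_leaf_tangent p U f (w : @vec R m M) :
  open U -> U p -> smooth_fun_on U f ->
  (forall q, leaf_in F U p q -> f q = f p) -> leaf_tangent F p w ->
  pairing p (differential f p) w = 0.
Proof.
move=> oU Up sf fp [tw w0]; have [c [Fc cp]] := fcharts_cover F p.
have hc := fcharts_charted Fc cp.
rewrite (pairingE (differential_cotangent oU Up sf) tw hc) mxE big1// => i _.
rewrite /differential (asboolT hc) [X in _ * X]mxE.
case: (ltnP i k) => ik; last by rewrite (w0 c Fc cp i ik) mul0r.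
by rewrite (partial_leaf_constant Fc cp oU Up fp ik) mulr0.
Qed.

(** The easy half of the Frobenius theorem for a one-form a vanishing on the
leaves: in a foliated chart the components of a along the first k axes vanish
identically, so the corresponding components d_i a_j - d_j a_i of da do too. *)
Lemma ext_deriv_leaf_tangent (a : @oneform R m M) p c (w w' : @vec R m M) :
  oneform_on setT a ->
  (forall q w, leaf_tangent F q w -> pairing q (a q) w = 0) ->
  charted c p -> leaf_tangent F p w -> leaf_tangent F p w' ->
  (w c *m ext_deriv a p c *m (w' c)^T) 0 0 = 0.
Proof.
move=> ha aF hc [tw w0] [tw' w0']; have [c' [Fc' c'p]] := fcharts_cover F p.
have hc' := fcharts_charted Fc' c'p.
have az q (i : 'I_m) : chart_dom c' q -> (i < k)%N -> a q c' i 0 = 0.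
  move=> c'q ik; have hq := fcharts_charted Fc' c'q.
  have tv := vec_of_coords_tangent (delta_mx 0 i) hq.
  have lv : leaf_tangent F q (vec_of_coords c' q (delta_mx 0 i)).
    apply: (leaf_tangent_in_chart Fc' c'q tv) => j kj.
    rewrite (vec_of_coordsK _ hq) mxE.
    by case: eqP => // _; case: eqP => // ji; move: ik; rewrite -ji ltnNge kj.
  have := aF _ _ lv; rewrite (pairingE (ha.1 q I) tv hq) (vec_of_coordsK _ hq).
  by rewrite -rowE mxE.
have nc : \forall q \near p, chart_dom c' q.
  by apply: open_nbhs_nbhs; split => //; exact: chart_dom_open.
have dz (i j : 'I_m) : (i < k)%N -> (j < k)%N -> ext_deriv a p c' i j = 0.
  move=> ik jk; rewrite /ext_deriv (asboolT hc') mxE.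
  have pz (l l' : 'I_m) : (l < k)%N ->
      partial (fun q => a q c' l 0) c' p l' = 0.
    move=> lk; rewrite (@eq_partial _ _ _ _ (fun=> 0) c' p l' c'p); last first.
      by apply: filterS nc => q /az; exact.
    exact: (derive_cst (0 : R^o)).
  by rewrite !pz ?subrr.
rewrite (ext_deriv_transition openT I ha hc hc').
rewrite !mulmxA -(tw.2 _ _ hc hc') -mulmxA -trmx_mul -(tw'.2 _ _ hc hc').
rewrite mxE big1// => j _; rewrite [X in X * _]mxE [X in _ * X]mxE.
case: (ltnP j k) => jk; last by rewrite (w0' _ Fc' c'p j jk) mulr0.
rewrite big1 ?mul0r// => i _.
case: (ltnP i k) => ik; last by rewrite (w0 _ Fc' c'p i ik) mul0r.
by rewrite dz ?mulr0.
Qed.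

End FoliatedCharts.

(** * Linear algebra *)

Lemma sum_option (V : nmodType) (I : finType) (F : option I -> V) :
  \sum_i F i = F None + \sum_j F (Some j).
Proof.
rewrite (bigD1 None)//=; congr (_ + _).
rewrite (reindex_omap Some id); last by case.
by apply: eq_bigl => j; rewrite eqxx.
Qed.

Lemma submx_pid (K : fieldType) (m n : nat) (w : 'rV[K]_m) :
  (w <= (pid_mx n : 'M[K]_m))%MS <-> forall j : 'I_m, (n <= j)%N -> w 0 j = 0.
Proof.
split=> [/submxP[x ->] j nj|w0].
  rewrite mxE big1// => k _; rewrite mxE.
  case: eqP => [kj|_]; last by rewrite mulr0.
  by rewrite [(k < n)%N]ltnNge kj nj mulr0.
apply/submxP; exists w; apply/rowP => j.
rewrite mxE (bigD1 j)//= big1 => [|k kj].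
  rewrite addr0 mxE eqxx/=; case: ltnP => [_|/w0 ->]; first by rewrite mulr1.
  by rewrite mul0r.
have kj' : (k == j :> nat) = false by exact: negbTE.
by rewrite mxE kj' mulr0.
Qed.

(** B is a 2-form whose kernel is the line of v, and the row space of E is an
isotropic subspace of dimension n.  The map x |-> x E B has rank at least n - 1,
as its kernel in the row space of E has dimension at most 1.  So the orthogonal
of E has dimension at most m - (n - 1) <= n; it contains E, hence is E. *)
Lemma isotropic_self_orthogonal (K : fieldType) (m n : nat) (B : 'M[K]_m)
    (a : 'cV[K]_m) (v u : 'rV[K]_m) (E : 'M[K]_m) :
  (m < 2 * n)%N -> B^T = - B -> v *m a = 1%:M -> v *m B = 0 ->
  (forall z : 'rV_m, z *m a = 0 -> z *m B = 0 -> z = 0) ->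
  \rank E = n -> E *m B *m E^T = 0 -> u *m B *m E^T = 0 -> (u <= E)%MS.
Proof.
move=> mn aB va vB nondeg rE EBE uBE.
(* If z B = 0, then z - a(z) v is in the kernels of both a and B. *)
have kv : (kermx B <= v)%MS.
  apply/row_subP => i; set z := row i _.
  have zB : z *m B = 0 by rewrite /z -row_mul mulmx_ker row0.
  apply/submxP; exists (z *m a); apply/eqP; rewrite -subr_eq0; apply/eqP.
  apply: nondeg; rewrite mulmxBl.
    by rewrite -[X in _ - X]mulmxA va mulmx1 subrr.
  by rewrite -[X in _ - X]mulmxA vB mulmx0 zB subrr.
have rk : (\rank (E :&: kermx B)%MS <= 1)%N.
  apply: leq_trans (rank_leq_row v); apply: mxrankS.
  exact: submx_trans (capmxSr _ _) kv.
have rEB : \rank (B *m E^T) = \rank (E *m B).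
  by rewrite -mxrank_tr trmx_mul trmxK aB mulmxN mxrank_opp.
have EK : (E <= kermx (B *m E^T))%MS by apply/sub_kermxP; rewrite mulmxA.
have uK : (u <= kermx (B *m E^T))%MS by apply/sub_kermxP; rewrite mulmxA.
apply: submx_trans uK _; rewrite -(mxrank_leqif_sup EK).2 eqn_leq mxrankS//=.
have := mxrank_mul_ker E B; rewrite mxrank_ker rEB rE; lia.
Qed.

Lemma free_family_spans (K : fieldType) (I : finType) (m : nat)
    (b : I -> 'rV[K]_m) (E : 'M[K]_m) (w : 'rV[K]_m) :
  \rank E = #|I| -> (forall i, (b i <= E)%MS) ->
  (forall r : I -> K, \sum_i r i *: b i = 0 -> forall i, r i = 0) ->
  (w <= E)%MS -> exists r : I -> K, w = \sum_i r i *: b i.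
Proof.
move=> rE bE bfree wE; pose B := \matrix_(i < #|I|) b (enum_val i).
have BE (x : 'rV_#|I|) : x *m B = \sum_i x 0 (enum_rank i) *: b i.
  rewrite mulmx_sum_row (reindex enum_rank)/=; last first.
    by exists enum_val => i _; [exact: enum_rankK|exact: enum_valK].
  by apply: eq_bigr => i _; rewrite rowK enum_rankK.
have fB : row_free B.
  apply: inj_row_free => x; rewrite BE => /bfree x0.
  by apply/rowP => i; rewrite mxE -(enum_valK i) x0.
have sBE : (B <= E)%MS by apply/row_subP => i; rewrite rowK.
have sEB : (E <= B)%MS by rewrite -(mxrank_leqif_sup sBE).2 (eqP fB) rE.
have /submxP[x ->] := submx_trans wE sEB.
by exists (fun i => x 0 (enum_rank i)); rewrite BE.
Qed.

(** * Cartan calculus on a manifold *)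

Section Tensors.
Context {R : realType} {m : nat} {M : manifold R m}.
Implicit Types (p q : M) (c : chart R m M) (U : set M) (f g : M -> R)
  (la : @oneform R m M) (X Y : @vfield R m M).

Lemma tangent_sum (I : finType) p (r : I -> R) (w : I -> @vec R m M) :
  (forall i, tangent p (w i)) -> tangent p (\sum_i r i *: w i).
Proof.
move=> tw.
have sE c : (\sum_i r i *: w i) c = \sum_i r i *: w i c by rewrite fct_sumE.
split=> [c nc|c c' hc hc']; rewrite !sE.
  by rewrite big1// => i _; rewrite (tw i).1 ?scaler0.
rewrite mulmx_suml; apply: eq_bigr => i _.
by rewrite -scalemxAl ((tw i).2 _ _ hc hc').
Qed.

Lemma ext_deriv_tr la p c : (ext_deriv la p c)^T = - ext_deriv la p c.
Proof.
rewrite /ext_deriv; case: asboolP => _; last by rewrite trmx0 oppr0.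
by apply/matrixP => i j; rewrite !mxE opprB.
Qed.

Lemma vfield_on_sub U X : vfield_on setT X -> vfield_on U X.
Proof.
move=> [tX sX]; split=> [p _|c cA k]; first exact: tX.
apply: C_on_sub (sX c cA k) => _ [p [cp _] <-].
by exists p.
Qed.

Lemma oneform_on_sub U la : oneform_on setT la -> oneform_on U la.
Proof.
move=> [tX sX]; split=> [p _|c cA k]; first exact: tX.
apply: C_on_sub (sX c cA k) => _ [p [cp _] <-].
by exists p.
Qed.

Lemma oneform_component_smooth U la c k :
  open U -> oneform_on U la -> atlas M c ->
  smooth_on (chart_coord c @` (chart_dom c `&` U))
    (fun x => la (chart_inv c x) c k 0 : R^o).
Proof.
move=> oU [_ sl] cA j; apply: C_on_entry; last exact: sl.
exact: chart_image_restr_open.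
Qed.

Lemma vfield_component_smooth U X c k : open U -> vfield_on U X -> atlas M c ->
  smooth_on (chart_coord c @` (chart_dom c `&` U))
    (fun x => X (chart_inv c x) c 0 k : R^o).
Proof.
move=> oU [_ sl] cA j; apply: C_on_entry; last exact: sl.
exact: chart_image_restr_open.
Qed.

(** L_X la = i_X d(la) + d(la(X)), where f is the function la(X): the Leibniz
rule applied to the sum that computes la(X) in the chart. *)
Lemma cartan_formula U la X f p c l : open U -> U p -> oneform_on U la ->
  vfield_on U X -> (forall q, U q -> pairing q (la q) (X q) = f q) ->
  charted c p ->
  lie_form X la p c l 0 = (X p c *m ext_deriv la p c) 0 l + partial f c p l.
Proof.
move=> oU Up hl hX hf hc.
have Ap : (chart_coord c @` (chart_dom c `&` U)) (chart_coord c p).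
  by exists p => //; split => //; case: hc.
pose FX k : 'rV[R]_m -> R^o := fun y => X (chart_inv c y) c 0 k.
pose Fl k : 'rV[R]_m -> R^o := fun y => la (chart_inv c y) c k 0.
have dX k : derivable (FX k) (chart_coord c p) (delta_mx 0 l).
  apply/diff_derivable.
  exact: smooth_on_differentiable (vfield_component_smooth k oU hX hc.1) Ap.
have dl k : derivable (Fl k) (chart_coord c p) (delta_mx 0 l).
  apply/diff_derivable.
  exact: smooth_on_differentiable (oneform_component_smooth k oU hl hc.1) Ap.
have pf : partial f c p l =
    \sum_k (partial (fun q => X q c 0 k) c p l * la p c k 0
            + X p c 0 k * partial (fun q => la q c k 0) c p l).
  have nU : \forall q \near p, U q by exact: open_nbhs_nbhs.
  transitivity ('D_(delta_mx 0 l) (fun y => \sum_k FX k y * Fl k y : R^o)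
                  (chart_coord c p)).
    apply: near_eq_derive.
    apply: filterS (near_chart hc.2 nU) => y [cy _ Uy] /=.
    by rewrite -(hf _ Uy) (pairingE (hl.1 _ Uy) (hX.1 _ Uy) (conj hc.1 cy)) mxE.
  rewrite (derive_val (is_derive := is_derive_sum_mul dX dl)).
  by apply: eq_bigr => k _; rewrite /FX /Fl (chart_coordK hc.2).
rewrite /lie_form (asboolT hc) mxE pf mxE -big_split/=; apply: eq_bigr => k _.
rewrite /ext_deriv (asboolT hc) mxE.
by move: (X p c 0 k) (la p c k 0) (partial _ c p k) (partial _ c p l)
  (partial _ c p l) => *; ring.
Qed.

(** The bracket lies in the kernels of both la and d(la), which meet only in
zero. *)
Lemma bracket_eq0 U la X Y p c : open U -> U p -> oneform_on U la ->
  vfield_on U X -> vfield_on U Y -> charted c p ->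
  (forall q c l, U q -> charted c q -> lie_form X la q c l 0 = 0) ->
  (forall q c l, U q -> charted c q -> lie_form Y la q c l 0 = 0) ->
  (forall q c, U q -> charted c q ->
     (X q c *m ext_deriv la q c *m (Y q c)^T) 0 0 = 0) ->
  (forall z : 'rV_m, z *m la p c = 0 -> z *m ext_deriv la p c = 0 -> z = 0) ->
  bracket X Y p c = 0.
Proof.
move=> oU Up hl hX hY hc LX LY lXY nondeg.
pose A := chart_coord c @` (chart_dom c `&` U).
have oA : open A by exact: chart_image_restr_open.
have Ap : A (chart_coord c p) by exists p => //; split => //; case: hc.
pose FX k : 'rV[R]_m -> R^o := fun y => X (chart_inv c y) c 0 k.
pose FY k : 'rV[R]_m -> R^o := fun y => Y (chart_inv c y) c 0 k.
pose Fl k : 'rV[R]_m -> R^o := fun y => la (chart_inv c y) c k 0.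
have sX k : smooth_on A (FX k) := vfield_component_smooth k oU hX hc.1.
have sY k : smooth_on A (FY k) := vfield_component_smooth k oU hY hc.1.
have sl k : smooth_on A (Fl k) := oneform_component_smooth k oU hl hc.1.
have extE k l q : charted c q ->
    local_ext Fl k l (chart_coord c q) = ext_deriv la q c k l.
  by move=> hq; rewrite /ext_deriv (asboolT hq) mxE.
have LX' l y : A y -> local_lie FX Fl l y = 0.
  move=> [q [cq Uq] <-]; have hq : charted c q := conj hc.1 cq.
  apply: etrans (LX q c l Uq hq); rewrite /lie_form (asboolT hq) [RHS]mxE.
  apply: eq_bigr => k _.
  by rewrite /FX /Fl (chart_coordK cq).
have LY' l y : A y -> local_lie FY Fl l y = 0.
  move=> [q [cq Uq] <-]; have hq : charted c q := conj hc.1 cq.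
  apply: etrans (LY q c l Uq hq); rewrite /lie_form (asboolT hq) [RHS]mxE.
  apply: eq_bigr => k _.
  by rewrite /FY /Fl (chart_coordK cq).
have lXY' y : A y -> \sum_k \sum_l FX k y * local_ext Fl k l y * FY l y = 0.
  move=> [q [cq Uq] <-]; have hq : charted c q := conj hc.1 cq.
  apply: etrans (lXY q c Uq hq); rewrite [RHS]mxE exchange_big.
  apply: eq_bigr => l _.
  rewrite [X in X * _]mxE mulr_suml [(Y q c)^T l 0]mxE; apply: eq_bigr => k _.
  by rewrite (extE k l q hq) /FX /FY (chart_coordK cq).
have bE k : bracket X Y p c 0 k = local_bracket FX FY k (chart_coord c p).
  rewrite /bracket (asboolT hc) mxE; apply: eq_bigr => j _.
  by rewrite /FX /FY (chart_coordK hc.2).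
apply: nondeg; apply/matrixP => i l; rewrite (ord1 i) [LHS]mxE [RHS]mxE.
  rewrite (ord1 l).
  apply: etrans (local_bracket_in_kernel LX' LY' lXY' Ap).
  by apply: eq_bigr => k _; rewrite bE /Fl (chart_coordK hc.2).
apply: etrans (local_bracket_ext oA sl sX sY LX' LY' lXY' l Ap).
by apply: eq_bigr => k _; rewrite bE (extE k l p hc).
Qed.

End Tensors.

(** * Co-Legendrian foliations tangent to the Reeb field *)

Section Contact.
Context {R : realType} {m : nat} {M : manifold R m}.
Context (xi : @plane_field R m M) (la : @oneform R m M) (v : @vfield R m M).
Hypotheses (hxi : contact_structure xi) (hla : contact_form la xi)
  (hv : reeb_field la v).

(** Complete non-integrability is a condition on one chosen chart at p and tests
against vectors of xi only.  Vectors killed by d(la) pass that test, and the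
transformation law of d(la) moves the conclusion to any chart. *)
Lemma contact_nondegenerate p c (z : 'rV[R]_m) : charted c p ->
  z *m la p c = 0 -> z *m ext_deriv la p c = 0 -> z = 0.
Proof.
move=> hc za zB; have [hl _ xiE] := hla.
have tz := vec_of_coords_tangent z hc.
have xz : xi p (vec_of_coords c p z).
  rewrite (xiE p I); split => //.
  by rewrite (pairingE (hl.1 p I) tz hc) (vec_of_coordsK _ hc) za mxE.
rewrite -(vec_of_coordsK z hc) (hxi.2 setT la openT hla p I _ xz)// => w' xw'.
have tw' : tangent p w' by move: xw'; rewrite (xiE p I) => -[].
have h0 := charted_at p.
rewrite /eval2 (ext_deriv_transition openT I hl h0 hc) !mulmxA.
rewrite -(tz.2 _ _ h0 hc).
by rewrite (vec_of_coordsK _ hc) zB !mul0mx mxE.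
Qed.

Lemma reeb_pairing p c : charted c p -> v p c *m la p c = 1%:M.
Proof.
move=> hc; have [hl _ _] := hla; have [[tv _] rv] := hv.
rewrite [LHS]mx11_scalar; congr (_%:M).
by rewrite -(pairingE (hl.1 p I) (tv p I) hc) (rv p).2.
Qed.

Lemma reeb_kernel p c : v p c *m ext_deriv la p c = 0.
Proof.
have [_ rv] := hv; have /(congr1 (fun a => a c)) := (rv p).1.
by rewrite /interior_product => /(congr1 trmx); rewrite trmxK trmx0.
Qed.

Lemma reeb_lie p c l : charted c p -> lie_form v la p c l 0 = 0.
Proof.
move=> hc; have [hl _ _] := hla; have [hvf rv] := hv.
rewrite (cartan_formula l openT I hl hvf (f := fun=> 1) _ hc); last first.
  by move=> q _; rewrite (rv q).2.
by rewrite reeb_kernel mxE add0r; exact: (derive_cst (1 : R^o)).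
Qed.

Context {n : nat} (F : foliation M n).
Hypotheses (hF : co_legendrian F xi)
  (hvF : forall p : M, leaf_tangent F p (v p)).

(** A vector w of TF differs from w - la(w) v, which lies in TF /\ xi, by a
multiple of v, and v is in the kernel of d(la); so it is enough to treat
TF /\ xi, which is tangent to a foliation G on which la vanishes. *)
Lemma co_legendrian_isotropic p c (w w' : @vec R m M) : charted c p ->
  leaf_tangent F p w -> leaf_tangent F p w' ->
  (w c *m ext_deriv la p c *m (w' c)^T) 0 0 = 0.
Proof.
move=> hc tw tw'; have [hl _ xiE] := hla.
have [_ [G GE]] := hF.
pose s x := pairing p (la p) x.
pose proj x := x - s x *: v p.
have projE x c' : proj x c' = x c' - s x *: v p c' by [].
have leafp x : leaf_tangent F p x -> leaf_tangent G p (proj x).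
  move=> lx; have lv := hvF p; rewrite GE.
  have tp : tangent p (proj x).
    split=> [c' nc|c1 c2 h1 h2]; rewrite !projE.
      by rewrite lx.1.1// lv.1.1// scaler0 subrr.
    by rewrite (lx.1.2 _ _ h1 h2) (lv.1.2 _ _ h1 h2) scalemxAl -mulmxBl.
  split.
    split=> // c' Fc' c'p j kj.
    rewrite projE !mxE (lx.2 _ Fc' c'p _ kj) (lv.2 _ Fc' c'p _ kj).
    by rewrite mulr0 subrr.
  rewrite (xiE p I); split => //.
  rewrite (pairingE (hl.1 p I) tp hc) projE mulmxBl -scalemxAl.
  rewrite (reeb_pairing hc).
  by rewrite !mxE eqxx/= mulr1 /s (pairingE (hl.1 p I) lx.1 hc) mxE subrr.
have aG q x : leaf_tangent G q x -> pairing q (la q) x = 0.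
  by rewrite GE => -[_]; rewrite (xiE q I) => -[].
have := ext_deriv_leaf_tangent hl aG hc (leafp _ tw) (leafp _ tw').
rewrite !projE mulmxBl -scalemxAl reeb_kernel scaler0 subr0 linearB linearZ/=.
rewrite mulmxBr -scalemxAr.
have -> : w c *m ext_deriv la p c *m (v p c)^T = 0.
  rewrite -[ext_deriv _ _ _]opprK -ext_deriv_tr mulmxN mulNmx -mulmxA -trmx_mul.
  by rewrite reeb_kernel trmx0 mulmx0 oppr0.
by rewrite scaler0 subr0.
Qed.

Hypothesis hm : (m < 2 * n)%N.

(** TF contains its own d(la)-orthogonal, by [isotropic_self_orthogonal] in a
foliated chart, where TF is the span of the first n axes. *)
Lemma orthogonal_leaf_tangent p (w : @vec R m M) : tangent p w ->
  (forall c w', charted c p -> leaf_tangent F p w' ->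
     (w c *m ext_deriv la p c *m (w' c)^T) 0 0 = 0) ->
  leaf_tangent F p w.
Proof.
move=> tw ort; have [c [Fc cp]] := fcharts_cover F p.
have hc := fcharts_charted Fc cp.
apply: (leaf_tangent_in_chart Fc cp tw) => j nj.
pose E : 'M[R]_m := pid_mx n.
have lE i : leaf_tangent F p (vec_of_coords c p (row i E)).
  apply: (leaf_tangent_in_chart Fc cp (vec_of_coords_tangent _ hc)) => k nk.
  rewrite (vec_of_coordsK _ hc) !mxE; case: eqP => //= ->.
  by rewrite ltnNge nk.
have EB0 (x : 'rV[R]_m) :
    (forall i, (x *m ext_deriv la p c *m (row i E)^T) 0 0 = 0) ->
    x *m ext_deriv la p c *m E^T = 0.
  move=> h; apply/rowP => i; rewrite [RHS]mxE -(h i) tr_row !mxE.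
  by apply: eq_bigr => k _; rewrite !mxE.
have /submx_pid : (w c <= E)%MS; last exact.
  apply: (isotropic_self_orthogonal hm (ext_deriv_tr la p c) (reeb_pairing hc)
    (reeb_kernel p c)).
  - by move=> z; exact: contact_nondegenerate.
  - by rewrite rank_pid_mx// (foliation_dim F).
  - apply/row_matrixP => i; rewrite row0 !row_mul; apply: EB0 => k.
    have := co_legendrian_isotropic hc (lE i) (lE k).
    by rewrite !(vec_of_coordsK _ hc).
  - apply: EB0 => i; have := ort c _ hc (lE i).
    by rewrite (vec_of_coordsK _ hc).
Qed.

End Contact.

Section Basis.
Context {R : realType} {m n : nat} {M : manifold R m} (F : foliation M n).

Lemma is_basis_of_leaf_tangent (I : finType) p (b : I -> @vec R m M) :
  #|I| = n -> (forall i, leaf_tangent F p (b i)) ->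
  (forall r : I -> R, \sum_i r i *: b i = 0 -> forall i, r i = 0) ->
  is_basis_of b (leaf_tangent F p).
Proof.
move=> cI lb bfree; split=> // w lw.
have [c [Fc cp]] := fcharts_cover F p; have hc := fcharts_charted Fc cp.
have sE (r : I -> R) : (\sum_i r i *: b i) c = \sum_i r i *: b i c.
  by rewrite fct_sumE.
have tb (r : I -> R) : tangent p (\sum_i r i *: b i).
  by apply: tangent_sum => i; have [] := lb i.
have inE x : leaf_tangent F p x -> (x c <= (pid_mx n : 'M[R]_m))%MS.
  by move=> lx; apply/submx_pid => j; exact: lx.2.
have [||| |r wr] :=
  @free_family_spans _ _ _ (fun i => b i c) (pid_mx n : 'M[R]_m) (w c).
- by rewrite rank_pid_mx ?(foliation_dim F).
- by move=> i; exact: inE.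
- move=> r r0; apply: bfree; apply: (tangent_eq hc (tb r)).
    by split=> [c' _|c1 c2 _ _]; rewrite ?mul0mx.
  by rewrite sE r0.
- exact: inE.
- exists r; apply: (tangent_eq hc lw.1 (tb r)).
  by rewrite sE.
Qed.

End Basis.

Theorem lemma3p7 (R : realType) (n : nat) (hn : (0 < n)%N)
    (M : manifold R (2 * n - 1)) (xi : @plane_field R (2 * n - 1) M)
    (hxi : contact_structure xi)
    (la : @oneform R (2 * n - 1) M) (hla : contact_form la xi)
    (v : @vfield R (2 * n - 1) M) (hv : reeb_field la v)
    (F : foliation M n) (hF : co_legendrian F xi)
    (hvF : forall p : M, leaf_tangent F p (v p))
    (U : set M) (hU : open U)
    (f : 'I_(n - 1) -> M -> R)
    (hfs : forall i, smooth_fun_on U (f i))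
    (hfi : functionally_independent_on U f)
    (hfF : leaves_are_levels F U f)
    (u : 'I_(n - 1) -> @vfield R (2 * n - 1) M)
    (hu : forall i, contact_vfield_on U la v (f i) (u i)) :
  (forall (i j : option 'I_(n - 1)) (p : M), U p ->
     bracket (with_reeb v u i) (with_reeb v u j) p = 0) /\
  (forall p : M, U p ->
     is_basis_of (fun i : option 'I_(n - 1) => with_reeb v u i p)
       (leaf_tangent F p)).
Proof.
have hm : (2 * n - 1 < 2 * n)%N by lia.
have [hl _ _] := hla.
have hlU : oneform_on U la by exact: oneform_on_sub.
(* A leaf of F in U lies in a connected component of a common level set, so each
   f i is constant on it. *)
have df0 i p w : U p -> leaf_tangent F p w ->
    pairing p (differential (f i) p) w = 0.
  move=> Up; apply: (differential_leaf_tangent hU Up (hfs i)) => q.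
  by rewrite (hfF p Up) => /connected_component_sub[_].
have lie0 i p c l : U p -> charted c p ->
    lie_form (with_reeb v u i) la p c l 0 = 0.
  case: i => [i|] Up hc; last exact: (reeb_lie hla hv).
  have [_ hui] := hu i; have [_ ->] := hui p Up.
  by rewrite (df0 i p _ Up (hvF p)) scale0r mxE.
have uB i p c : U p -> charted c p ->
    u i p c *m ext_deriv la p c = - (differential (f i) p c)^T.
  move=> Up hc; have [hui huf] := hu i; apply/rowP => l.
  have := lie0 (Some i) p c l Up hc.
  rewrite (cartan_formula l hU Up hlU hui (fun q Uq => (huf q Uq).1) hc).
  move=> /eqP; rewrite addr_eq0 => /eqP ->.
  by rewrite /differential (asboolT hc) !mxE.
have leafW i p : U p -> leaf_tangent F p (with_reeb v u i p).
  case: i => [i|] Up; last exact: hvF.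
  have [[tu _] _] := hu i.
  apply: (orthogonal_leaf_tangent hxi hla hv hF hvF hm (tu p Up)) => c w hc lw.
  rewrite (uB i p c Up hc) mulNmx mxE -trmx_mul mxE.
  rewrite -(pairingE (differential_cotangent hU Up (hfs i)) lw.1 hc).
  by rewrite df0 ?oppr0.
have fieldW i : vfield_on U (with_reeb v u i).
  by case: i => [i|]; [have [] := hu i|apply: vfield_on_sub; have [] := hv].
split=> [i j p Up|p Up].
  apply/funext => c; have [hc|nc] := pselect (charted c p); last first.
    by rewrite /bracket asboolF.
  rewrite -[RHS]/(0 : 'rV[R]_(2 * n - 1)).
  apply: (bracket_eq0 hU Up hlU (fieldW i) (fieldW j) hc).
  - by move=> q c' l Uq hq; exact: lie0.
  - by move=> q c' l Uq hq; exact: lie0.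
  - move=> q c' Uq hq.
    exact: (co_legendrian_isotropic hla hv hF hvF hq
              (leafW i q Uq) (leafW j q Uq)).
  - by move=> z; exact: (contact_nondegenerate hxi hla hc).
apply: is_basis_of_leaf_tangent => [|i|r r0].
  by rewrite card_option card_ord; lia.
  exact: leafW.
have e c : \sum_i r i *: with_reeb v u i p c = 0.
  by have /(congr1 (fun w => w c)) := r0; rewrite fct_sumE.
(* Contracting the relation with d(la) kills v and turns u_j into - df_j. *)
have rS j : r (Some j) = 0.
  apply: (hfi p Up (fun j => r (Some j))); apply/funext => c.
  have [hc|nc] := pselect (charted c p); last first.
    rewrite fct_sumE big1// => i _.
    rewrite -[LHS]/(r (Some i) *: differential (f i) p c) /differential.
    by rewrite asboolF ?scaler0.
  have /(congr1 (fun w => (w *m ext_deriv la p c)^T)) := e c.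
  rewrite sum_option mulmxDl -scalemxAl (reeb_kernel hv) scaler0 add0r.
  rewrite mul0mx trmx0 mulmx_suml linear_sum/= => z.
  rewrite fct_sumE -[RHS]/(0 : 'cV[R]_(2 * n - 1)); apply: oppr_inj.
  rewrite oppr0 -[RHS]z -sumrN; apply: eq_bigr => i _.
  rewrite -scalemxAl (uB i p c Up hc) scalerN [RHS]linearN/=.
  by rewrite [(_ *: _)^T]linearZ/= trmxK.
(* What remains is a multiple of v, on which la takes the value 1. *)
case=> [j|]; first exact: rS.
have h0 := charted_at p; have := e (chart_at p).
rewrite sum_option big1 ?addr0 => [|j _]; last by rewrite rS scale0r.
move=> /(congr1 (fun w => (w *m la p (chart_at p)) 0 0)).
by rewrite -scalemxAl (reeb_pairing hla hv h0) mul0mx !mxE eqxx mulr1.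
Qed.
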